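(* For any connected graph $G$ of order at least $2$, $Z(G) \le 2 Z(L(G))$.
   Context: All graphs are finite, simple and undirected. $L(G)$ is the line graph of $G$. Zero forcing: each vertex of a graph $H$ is colored black or white; if a black vertex $u$ has exactly one white neighbor $w$, then $w$ becomes black (color-change rule). $S \subseteq V(H)$ is a zero forcing set if, starting with exactly $S$ black, repeated application of the rule makes every vertex black. $Z(H)$ is the minimum size of a zero forcing set of $H$. *)

(* Defs.v *)
From mathcomp Require Import all_boot.

Set Implicit Arguments.
Unset Strict Implicit.
Unset Printing Implicit Defensive.

Record sgraph := SGraph {
  vertex :> finType;
  adj : rel vertex;
  adj_sym : symmetric adj;
  adj_irr : irreflexive adj }.

Arguments adj {_}.

Definition connected (G : sgraph) : Prop := forall x y : G, connect adj x y.

Definition edges (G : sgraph) : {set {set G}} :=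
  [set A | [exists x, exists y, adj x y && (A == [set x; y])]].

Section LineGraph.
Variable G : sgraph.

Definition edge_type : finType := {A : {set G} | A \in edges G}.

Definition edge_adj : rel edge_type :=
  [rel A B | (A != B) && (val A :&: val B != set0)].

Lemma edge_adj_sym : symmetric edge_adj.
Proof. by move=> A B; rewrite /edge_adj /= eq_sym setIC. Qed.

Lemma edge_adj_irr : irreflexive edge_adj.
Proof. by move=> A; rewrite /edge_adj /= eqxx. Qed.

Definition line_graph : sgraph := SGraph edge_adj_sym edge_adj_irr.

End LineGraph.

Section ZeroForcing.
Variable H : sgraph.
(* A coloring is represented by its set B of black vertices. *)
Implicit Types (B S : {set H}).

Definition forces B (u w : H) : bool :=
  (u \in B) && ([set v | adj u v & v \notin B] == [set w]).

Definition color_change : rel {set H} :=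
  [rel B B' | [exists u, exists w, forces B u w && (B' == w |: B)]].

Definition zero_forcing_set S : bool := connect color_change S [set: H].

(* The default candidate [set: H] is itself a zero forcing set (connect0), so
   the arg min ranges over a nonempty family. *)
Definition zero_forcing_number : nat :=
  #|[arg min_(S < [set: H] | zero_forcing_set S) #|S|]|.

End ZeroForcing.

(* Main.v *)
Require Import Defs.
From mathcomp Require Import all_boot.

(** If the edge [e = uv] forces the edge [f = vw] in the line graph, then every
    edge at [v] other than [f] is black. Hence, when the endpoints of all black
    edges are black in [G], every neighbour of [v] other than [w] is black, and
    [v] can force [w] (unless [w] is already black). So the endpoints of a zero
    forcing set of [L(G)] form a zero forcing set of [G], of at most twice the
    size; no vertex is missed because [G] has no isolated vertex. *)

Section Endpoints.
Variable G : sgraph.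
Implicit Types (e f : line_graph G) (B S : {set line_graph G}) (u v w x : G).

Definition endpoints B : {set G} := \bigcup_(e in B) val e.

Lemma mem_endpoints B e v : e \in B -> v \in val e -> v \in endpoints B.
Proof. by move=> eB ve; apply/bigcupP; exists e. Qed.

(** Lets an edge be read from either end, so that the vertex it shares with another edge can come
    first. *)
Lemma edge_endpoint e v : v \in val e ->
  exists2 w, adj v w & val e = [set v; w].
Proof.
have := valP e; rewrite inE => /existsP[x /existsP[y /andP[xy /eqP ->]]].
rewrite !inE => /orP[] /eqP ->; first by exists y.
by exists x; rewrite 1?adj_sym // setUC.
Qed.

Lemma adj_edge v w : adj v w -> exists e, val e = [set v; w].
Proof.
move=> vw; have vwE : [set v; w] \in edges G.
  by rewrite inE; apply/existsP; exists v; apply/existsP; exists w; rewrite vw /=.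
by exists (Sub [set v; w] vwE).
Qed.

Lemma card_endpoints B : #|endpoints B| <= 2 * #|B|.
Proof.
rewrite mulnC -sum_nat_const /endpoints.
(* Union bound; each edge then contributes at most 2. *)
apply: (@leq_trans (\sum_(e in B) #|val e|)).
  elim/big_rec2: _ => [|e n A _ leAn]; first by rewrite cards0.
  by apply: leq_trans (leq_card_setU _ _) _; rewrite leq_add2l.
apply: leq_sum => e _; have := valP e; rewrite inE.
by move=> /existsP[x /existsP[y /andP[_ /eqP ->]]]; rewrite cards2; case: (x != y).
Qed.

Lemma endpointsU1 f B : endpoints (f |: B) = val f :|: endpoints B.
Proof. by rewrite /endpoints bigcup_setU big_set1. Qed.

(** One step in [line_graph G] becomes one step in [G] or none, hence [connect] in the
    conclusion. *)
Lemma endpoints_color_change B B' : color_change B B' ->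
  connect (@color_change G) (endpoints B) (endpoints B').
Proof.
case/existsP=> e /existsP[f /andP[/andP[eB /eqP forced] /eqP ->{B'}]].
have : f \in [set g | adj e g & g \notin B] by rewrite forced set11.
rewrite inE => /andP[/andP[_ /set0Pn[v /setIP[ve vf]]] _].
have [w vw fE] := edge_endpoint _ _ vf.
have vB := mem_endpoints _ _ _ eB ve.
(* As an end of [e], [v] is already black, so blackening [f] adds at most its other end [w]. *)
have -> : endpoints (f |: B) = w |: endpoints B.
  rewrite endpointsU1 fE [[set v; w]]setUC -setUA.
  by congr (_ :|: _); apply/setUidPr; rewrite sub1set.
have [wB | wNB] := boolP (w \in endpoints B).
  by rewrite (setUidPr _) ?sub1set.
apply/connect1/existsP; exists v; apply/existsP; exists w.
rewrite eqxx andbT /forces vB; apply/eqP/setP=> x; rewrite !inE.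
apply/andP/eqP=> [[vx xNB] | ->]; last by [].
(* The edge [g] joining [v] to the white vertex [x] is itself white, and it meets the black edge [e]
   at [v]. As [f] is the only white neighbour of [e], [g = f] and so [x = w]. *)
have [g gE] := adj_edge _ _ vx.
have vg : v \in val g by rewrite gE set21.
have xg : x \in val g by rewrite gE set22.
have gNB : g \notin B.
  by apply: contra xNB => gB; apply: mem_endpoints gB xg.
have : g \in [set f].
  rewrite -forced inE gNB andbT /= /edge_adj /=; apply/andP; split.
    by apply: contraNneq gNB => <-.
  by apply/set0Pn; exists v; rewrite inE ve vg.
move/set1P=> gf; move: xg; rewrite gf fE => /set2P[xv|//].
by move: vx; rewrite xv adj_irr.
Qed.

Lemma endpoints_connect B B' : connect (@color_change (line_graph G)) B B' ->
  connect (@color_change G) (endpoints B) (endpoints B').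
Proof.
case/connectP=> p; elim: p B => [|C p IHp] B /= => [_ ->|]; first exact: connect0.
move=> /andP[BC Cp] B'E.
exact: connect_trans (endpoints_color_change _ _ BC) (IHp _ Cp B'E).
Qed.

Lemma connected_neighbor v : connected G -> 2 <= #|G| -> exists w, adj v w.
Proof.
move=> Gconn /card_gt1P[x [y [_ _ xy]]].
have [w wv] : exists w, w != v.
  by have [xv|] := eqVneq x v; [exists y; rewrite -xv eq_sym | exists x].
(* A path from [v] to a different vertex is nonempty, and its first step reaches a neighbour of
   [v]. *)
have /connectP[[|u p] /= vp wE] := Gconn v w; first by rewrite wE eqxx in wv.
by exists u; case/andP: vp.
Qed.

Lemma endpointsT : connected G -> 2 <= #|G| -> endpoints setT = setT.
Proof.
move=> Gconn Gorder; apply/setP=> v; rewrite inE.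
have [w /adj_edge[e eE]] := connected_neighbor v Gconn Gorder.
by apply: (mem_endpoints _ e); rewrite ?inE // eE set21.
Qed.

Lemma endpoints_zero_forcing S : connected G -> 2 <= #|G| ->
  zero_forcing_set S -> zero_forcing_set (endpoints S).
Proof.
by move=> Gconn Gorder /endpoints_connect; rewrite endpointsT.
Qed.

End Endpoints.

Lemma zero_forcing_number_le (H : sgraph) (S : {set H}) :
  zero_forcing_set S -> zero_forcing_number H <= #|S|.
Proof.
move=> SF; rewrite /zero_forcing_number.
by case: arg_minnP => [|T _]; [exact: connect0 | exact].
Qed.

Lemma zero_forcing_number_witness (H : sgraph) :
  exists2 S : {set H}, zero_forcing_set S & #|S| = zero_forcing_number H.
Proof.
rewrite /zero_forcing_number.
by case: arg_minnP => [|T TF _]; [exact: connect0 | exists T].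
Qed.

Theorem theorem3p11 (G : sgraph) (Gconn : connected G) (Gorder : 2 <= #|G|) :
  zero_forcing_number G <= 2 * zero_forcing_number (line_graph G).
Proof.
have [S SF <-] := zero_forcing_number_witness (line_graph G).
apply: leq_trans (card_endpoints _ S).
exact/zero_forcing_number_le/endpoints_zero_forcing.
Qed.
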